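(* Let $p$ be an odd prime and let $G$ be a finite $p$-group of maximal class of order $p^n$ with $4 \leq n \leq p+1$. Then the Schur multiplier $M(G)$ of $G$ is elementary abelian (i.e. $M(G)$ is an elementary abelian $p$-group).
   Context: A finite $p$-group of order $p^n$ is of maximal class if its nilpotency class is $n-1$. The Schur multiplier of a finite group $G$ is $M(G) = H_2(G, \mathbb{Z})$, the second integral homology group, with $\mathbb{Z}$ regarded as a trivial $G$-module. *)

(* Defs.v *)
From HB Require Import structures.
From mathcomp Require Import all_boot all_order all_algebra all_fingroup all_solvable.
From mathcomp Require Import ring boolp.

Set Implicit Arguments.
Unset Strict Implicit.
Unset Printing Implicit Defensive.

Import GRing.Theory.
Local Open Scope ring_scope.

(* Homology at B of a pair of additive maps A --f--> B --g--> C. *)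
Section Homology.
Variables (A B C : zmodType) (f : {additive A -> B}) (g : {additive B -> C}).

Definition in_kernel : {pred B} := fun b => g b == 0.

Fact in_kernel_zmod_closed : zmod_closed in_kernel.
Proof.
split=> [|x y]; rewrite !unfold_in ?raddf0 // => /eqP gx /eqP gy.
by rewrite raddfB gx gy subr0.
Qed.
HB.instance Definition _ :=
  GRing.isZmodClosed.Build B in_kernel in_kernel_zmod_closed.

Record cycles := Cycle { cycle_val : B; _ : cycle_val \in in_kernel }.
HB.instance Definition _ := [isSub for cycle_val].
HB.instance Definition _ := [Choice of cycles by <:].
HB.instance Definition _ := [SubChoice_isSubZmodule of cycles by <:].

Definition boundaries : {pred cycles} := fun z => `[< exists a : A, val z = f a >].

Fact boundaries_zmod_closed : zmod_closed boundaries.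
Proof.
split=> [|x y]; rewrite !unfold_in; first by apply/asboolP; exists 0; rewrite !raddf0.
move=> /asboolP[a xa] /asboolP[b yb]; apply/asboolP; exists (a - b).
by rewrite [RHS]raddfB -xa -yb raddfB.
Qed.
HB.instance Definition _ :=
  GRing.isZmodClosed.Build cycles boundaries boundaries_zmod_closed.

Definition homology : zmodType := @Quotient.quot cycles boundaries.

End Homology.

(* Degrees 1, 2, 3 of the inhomogeneous bar complex of a finite group, with   *)
(* coefficients in the trivial module Z. The free abelian group on a finite   *)
(* set X is {ffun X -> int}, with basis the [free_gen x], and (g, h, k)       *)
(* stands for the bar symbol [g|h|k].                                         *)
Section BarComplex.
Variable gT : finGroupType.

Definition bar1 : zmodType := {ffun gT -> int}.
Definition bar2 : zmodType := {ffun gT * gT -> int}.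
Definition bar3 : zmodType := {ffun gT * gT * gT -> int}.

Definition free_gen (X : finType) (x : X) : {ffun X -> int} :=
  [ffun y => (y == x)%:R].

Definition bar_d2_gen (u : gT * gT) : bar1 :=
  let: (g, h) := u in free_gen h - free_gen (g * h)%g + free_gen g.

Definition bar_d3_gen (u : gT * gT * gT) : bar2 :=
  let: (g, h, k) := u in
  free_gen (h, k) - free_gen ((g * h)%g, k)
    + free_gen (g, (h * k)%g) - free_gen (g, h).

Definition bar_d2 (c : bar2) : bar1 := \sum_u bar_d2_gen u *~ c u.
Definition bar_d3 (c : bar3) : bar2 := \sum_u bar_d3_gen u *~ c u.

Fact bar_d2_zmod_morphism : zmod_morphism bar_d2.
Proof.
move=> x y; rewrite /bar_d2 -sumrB; apply: eq_bigr => u _.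
by rewrite !ffunE mulrzBr.
Qed.
HB.instance Definition _ :=
  GRing.isZmodMorphism.Build bar2 bar1 bar_d2 bar_d2_zmod_morphism.

Fact bar_d3_zmod_morphism : zmod_morphism bar_d3.
Proof.
move=> x y; rewrite /bar_d3 -sumrB; apply: eq_bigr => u _.
by rewrite !ffunE mulrzBr.
Qed.
HB.instance Definition _ :=
  GRing.isZmodMorphism.Build bar3 bar2 bar_d3 bar_d3_zmod_morphism.

Lemma bar_d2_free_gen u : bar_d2 (free_gen u) = bar_d2_gen u.
Proof.
rewrite /bar_d2 (bigD1 u) //= ffunE eqxx mulr1z big1 ?addr0 // => v vu.
by rewrite ffunE (negPf vu) mulr0z.
Qed.

Lemma bar_d2_d3 c : bar_d2 (bar_d3 c) = 0.
Proof.
rewrite {1}/bar_d3 raddf_sum big1 // => -[[g h] k] _.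
rewrite raddfMz /= !(raddfB, raddfD) /= !bar_d2_free_gen /= mulgA.
apply/ffunP => x; rewrite ffunMzE !ffunE.
by rewrite [X in X *~ _](_ : _ = 0) ?mul0rz //; ring.
Qed.

Definition H2 : zmodType := homology bar_d3 bar_d2.

End BarComplex.

Definition schur_multiplier (gT : finGroupType) (G : {group gT}) : zmodType :=
  H2 (subg_of G).

Definition elementary_abelian (p : nat) (V : zmodType) : Prop :=
  forall x : V, x *+ p = 0.

Definition maximal_class (gT : finGroupType) (p n : nat) (G : {group gT}) : Prop :=
  #|G| = (p ^ n)%N /\ nil_class G = n.-1.

(* Main.v *)
Require Import Defs.
From HB Require Import structures.
From mathcomp Require Import all_boot all_order all_algebra all_fingroup all_solvable.
From mathcomp Require Import generic_quotient ring_quotient.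
From mathcomp Require Import boolp zify ring.

(** Let N = |G|. The bar chains of degree 2, modulo boundaries and modulo N, are
    the coefficients of a universal cocycle, hence of a finite central extension
    E of G by an abelian group A. The map sending a cycle to its class in A takes
    values in the derived subgroup E' (ext_inj_commutator), and its kernel
    consists of boundaries because |G| annihilates H_2 (card_cycle_boundary). So
    it is enough to prove a statement about finite groups
    (central_ext_exponent): if A is central in E and E / A is of maximal class
    of order p ^ n with 4 <= n <= p + 1, then every element of E' that lies in A
    has order dividing p.

    The tool for this is P. Hall's regularity: in a group H of class less than p,
    x ^+ q = y ^+ q implies (x^-1 * y) ^+ q = 1 for every power q of p
    (small_class_regularX). It is derived from the Hall-Petrescu formula, which is
    obtained from polynomial sequences in nilpotent groups, without any
    collection process.

    The group E itself may have class p + 1, which is too large. But let K / A be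
    the maximal subgroup of E / A that centralises the quotient of the second by
    the fourth term of the lower central series. Its commutators fall one step
    deeper than usual, and K has class less than p (central_ext_maximal_class). It
    contains E', so regularity applies to E'. In E / A itself, the bound
    n <= p + 1 leaves room for enough elements acting uniserially; their p-th
    powers are central, and so p-th powers of all elements are central (mc_power)
    and the derived subgroup has exponent p (mc_der1_exponent).

    Now choose x in K and s in E that together with E' and A generate E, and put
    c = [x, s], so that E' is generated by c and the third term of the lower
    central series of E. Regularity turns the centrality of d ^+ p for d in E'
    into the triviality of [d, g] ^+ p, and the centrality of x ^+ (p ^ 2) into
    c ^+ (p ^ 2) = 1. The third term therefore has exponent p, and an element of
    E' that lies in A has the form c ^+ (p * j) * t with t in the third term; its
    p-th power is c ^+ (p ^ 2 * j) = 1. *)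

Set Implicit Arguments.
Unset Strict Implicit.
Unset Printing Implicit Defensive.

Import GroupScope.

(** * Polynomial sequences and the Hall-Petrescu formula *)

Section PolynomialSequences.
Variables (gT : finGroupType) (F : nat -> {group gT}).
Hypothesis F_anti : forall i, F i.+1 \subset F i.
Hypothesis F_comm : forall i j, [~: F i, F j] \subset F (i + j).

Lemma filtration_leq i j : i <= j -> F j \subset F i.
Proof.
by move/subnK <-; elim: (j - i) => // l; apply: subset_trans (F_anti _).
Qed.

Definition delta (f : nat -> gT) (n : nat) : gT := (f n)^-1 * f n.+1.

(** The polynomial sequences of Leibman for the filtration F: the j-th difference
    of f takes its values in F (i + j), here only for j up to k. The
    truncation at k is what makes the closure properties provable by
    induction. *)
Fixpoint poly_seq k i (f : nat -> gT) : Prop :=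
  (forall n, f n \in F i) /\
  (if k is k'.+1 then poly_seq k' i.+1 (delta f) else True).

Lemma poly_seq_val k i f n : poly_seq k i f -> f n \in F i.
Proof. by case: k => [|k] []. Qed.

Lemma poly_seqW k i f : poly_seq k.+1 i f -> poly_seq k i f.
Proof.
elim: k i f => [|k IHk] i f [fF df]; first by [].
by split=> //; apply: IHk.
Qed.

Lemma poly_seq_anti k i f : poly_seq k i.+1 f -> poly_seq k i f.
Proof.
elim: k i f => [|k IHk] i f [fF df]; split=> // *.
- exact: subsetP (F_anti i) _ (fF _).
- exact: subsetP (F_anti i) _ (fF _).
- exact: IHk.
Qed.

Lemma poly_seq_leq k i j f : i <= j -> poly_seq k j f -> poly_seq k i f.
Proof.
by move/subnK <-; elim: (j - i) => // m IHm /poly_seq_anti.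
Qed.

(** Each of these operations has a difference that is a product of conjugates
    and commutators of the given sequences and their differences. These are
    known to be polynomial at depth k, so depth k.+1 follows. The commutator
    formula involves [f, g] itself, which is harmless because it too is already
    known to depth k. *)
Lemma poly_seq_group k :
  [/\ forall i f g, poly_seq k i f -> poly_seq k i g ->
        poly_seq k i (fun n => f n * g n),
      forall i f, poly_seq k i f -> poly_seq k i (fun n => (f n)^-1)
    & forall i j f g, poly_seq k i f -> poly_seq k j g ->
        poly_seq k (i + j) (fun n => [~ f n, g n])].
Proof.
elim: k => [|k [IHM IHV IHR]].
  split=> [i f g [fF _] [gF _]|i f [fF _]|i j f g [fF _] [gF _]]; split=> // n.
  - by rewrite groupM.
  - by rewrite groupV.
  - by rewrite (subsetP (F_comm i j)) ?mem_commg.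
have IHJ i j f g : poly_seq k i f -> poly_seq k j g ->
    poly_seq k i (fun n => f n ^ g n).
  move=> Pf Pg; under eq_fun do rewrite conjg_mulR.
  apply: IHM => //; apply: poly_seq_leq (leq_addr j i) _.
  exact: IHR.
split=> [i f g Pf Pg|i f Pf|i j f g Pf Pg].
- split=> [n|]; first by rewrite groupM ?(poly_seq_val _ Pf) ?(poly_seq_val _ Pg).
  rewrite (_ : delta _ = fun n => delta f n ^ g n * delta g n); last first.
    by apply/funext=> n; rewrite /delta /conjg !invMg !mulgA mulgK.
  by apply: IHM; last exact: Pg.2; apply: IHJ Pf.2 (poly_seqW Pg).
- split=> [n|]; first by rewrite groupV (poly_seq_val _ Pf).
  rewrite (_ : delta _ = fun n => (delta f n)^-1 ^ (f n)^-1); last first.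
    by apply/funext=> n; rewrite /delta /conjg !invMg !invgK !mulgA mulgK.
  by apply: IHJ (IHV _ _ Pf.2) (IHV _ _ (poly_seqW Pf)).
- split=> [n|].
    rewrite (subsetP (F_comm i j)) ?mem_commg //.
      exact: poly_seq_val Pf.
    exact: poly_seq_val Pg.
  have [Pf' Pg'] := (poly_seqW Pf, poly_seqW Pg); have [_ Pa] := Pf; have [_ Pb] := Pg.
  set a := delta f in Pa; set b := delta g in Pb.
  rewrite (_ : delta _ = fun n =>
      ([~ f n, b n] ^ a n * [~ a n, b n]) ^ [~ f n, g n]
      * ([~ [~ f n, g n], a n * b n] * [~ a n, g n] ^ b n)); last first.
    apply/funext=> n; rewrite {1}/delta.
    have -> : f n.+1 = f n * a n by rewrite mulKVg.
    have -> : g n.+1 = g n * b n by rewrite mulKVg.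
    move: (f n) (g n) (a n) (b n) => x y u v.
    rewrite commgMJ (commMgJ x u v) (commMgJ x u y).
    move: [~ x, y] (_ * [~ u, v]) => c {}x.
    by rewrite [[~ c, _]]commgEl conjMg -conjgM [x ^ c]conjgE !mulgA !mulgK.
  apply: (IHM); [apply: (IHJ _ (i + j)) | apply: (IHM)].
  + apply: (IHM); first apply: (IHJ _ i.+1) => //.
      by rewrite -addnS; apply: IHR.
    by apply: poly_seq_leq (IHR _ _ _ _ Pa Pb); rewrite addSn ltnS leq_add2l.
  + exact: IHR.
  + rewrite -addn1; apply: (IHR); first exact: IHR.
    by apply: (IHM); [apply: poly_seq_leq Pa | apply: poly_seq_leq Pb].
  + by apply: (IHJ _ j.+1) => //; rewrite -addSn; apply: IHR.
Qed.

(** The differences of such a sequence are given by Pascal's rule. *)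
Lemma poly_seq_binomial k i m g :
  g \in F (i + m) -> poly_seq k i (fun n => g ^+ 'C(n, m)).
Proof.
elim: k i m g => [|k IHk] i m g Fg.
  by split=> //= n; rewrite groupX ?(subsetP (filtration_leq (leq_addr m i))).
split=> [n|] /=; first by rewrite groupX ?(subsetP (filtration_leq (leq_addr m i))).
case: m Fg => [|m] Fg.
  rewrite (_ : delta _ = fun n => 1 ^+ 'C(n, 0)); first exact: IHk.
  by apply/funext=> n; rewrite /delta !bin0 mulVg.
rewrite (_ : delta _ = fun n => g ^+ 'C(n, m)); first by apply: IHk; rewrite addSnnS.
by apply/funext=> n; rewrite /delta binS expgD mulKg.
Qed.

Lemma delta_vanish k (f : nat -> gT) :
  (forall n, n < k.+1 -> f n = 1) -> forall n, n < k -> delta f n = 1.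
Proof. by move=> f1 n ltnk; rewrite /delta !f1 ?mulVg // ltnW. Qed.

Lemma poly_seq_lead k i f :
  poly_seq k i f -> (forall n, n < k -> f n = 1) -> f k \in F (i + k).
Proof.
elim: k i f => [|k IHk] i f [fF Pf] f1; first by rewrite addn0.
have := IHk _ _ Pf (delta_vanish f1).
by rewrite /delta f1 // invg1 mul1g addSnnS.
Qed.

Lemma poly_seq_trivial k i f : F (i + k) :=: 1 ->
  poly_seq k i f -> (forall n, n < k -> f n = 1) -> forall n, f n = 1.
Proof.
elim: k i f => [|k IHk] i f F1 [fF Pf] f1 n.
  by have := fF n; rewrite -(addn0 i) F1 => /set1P.
have df1 := IHk i.+1 _ _ Pf (delta_vanish f1).
elim: n => [|n IHn]; first exact: f1.
have: delta f n = 1 by apply: df1; rewrite addSnnS.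
by rewrite /delta IHn invg1 mul1g.
Qed.

(** Newton interpolation: f is divided successively by the sequences
    n |-> g_m ^+ 'C(n, m), with g_m the first nontrivial value, until it
    vanishes on [0, p[ and is therefore trivial. At n = q all the exponents
    'C(q, m) that occur are multiples of q. *)
Lemma poly_seq_power p q f : 1 < p -> F p :=: 1 ->
    (forall k, 0 < k < p -> q %| 'C(q, k)) ->
    (forall k, poly_seq k 0 f) -> f 0%N = 1 -> f 1%N = 1 ->
  f q \in <<[set d ^+ q | d in F 2]>>.
Proof.
move=> p_gt1 Fp1 q_bin Pf f0 f1.
suff gen j m h : j + m = p -> 1 < m -> (forall k, poly_seq k 0 h) ->
    (forall n, n < m -> h n = 1) -> h q \in <<[set d ^+ q | d in F 2]>>.
  by apply: (gen (p - 2) 2); rewrite ?subnK // => -[|[]].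
elim: j m h => [|j IHj] {f Pf f0 f1} m f def_p m_gt1 Pf fm.
  rewrite (@poly_seq_trivial p 0 f) ?group1 // => n ltnp.
  by rewrite fm // -[m]add0n def_p.
pose g := f m; have Fg : g \in F m by exact: (poly_seq_lead (Pf m) fm).
pose f' n := g ^- 'C(n, m) * f n.
have -> : f q = g ^+ 'C(q, m) * f' q by rewrite mulKVg.
apply: groupM.
  have /dvdnP[t ->] : q %| 'C(q, m).
    by apply: q_bin; rewrite -def_p addSn ltnS leq_addl andbT ltnW.
  rewrite expgM mem_gen // (imset_f (fun d => d ^+ q)) //.
  by rewrite groupX // (subsetP (filtration_leq m_gt1)).
apply: (IHj m.+1); rewrite ?addnS -?addSn // ?leqW //; [move=> k | move=> n].
  have [PM PV _] := poly_seq_group k.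
  by apply: PM (Pf k); apply: PV; apply: poly_seq_binomial.
rewrite ltnS leq_eqVlt /f' => /predU1P[-> | ltnm].
  by rewrite binn expg1 mulVg.
by rewrite bin_small // fm // expg0 invg1 mulg1.
Qed.

End PolynomialSequences.

(** The three subgroups lemma in G / 'L_(i + j)(G), by induction on j. *)
Lemma lcn_comm (gT : finGroupType) (G : {group gT}) i j :
  [~: 'L_i(G), 'L_j(G)] \subset 'L_(i + j)(G).
Proof.
have L0 k : [~: 'L_0(G), 'L_k(G)] \subset 'L_(0 + k)(G).
  by rewrite commg_subr lcn_norm.
case: i => // i; case: j => [|j]; first by rewrite addn0 commGC L0.
elim: j i => [|j IHj] i; first by rewrite lcn1 addn1 lcnSnS.
rewrite lcnSn commGC; set N := 'L_(_ + _)(G).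
have nNG : G \subset 'N(N) by apply: lcn_norm.
have nNL k : 'L_k(G) \subset 'N(N) by rewrite (subset_trans (lcn_sub _ _)).
have cent3 (X Y W : {group gT}) : [~: X, Y, W] \subset N ->
    X \subset G -> Y \subset G -> W \subset G ->
    [~: X / N, Y / N, W / N] = 1.
  move=> sN sX sY sW; have nN (V : {set gT}) (sV : V \subset G) : V \subset 'N(N).
    exact: subset_trans sV nNG.
  have nR : [~: X, Y] \subset 'N(N) by rewrite nN // comm_subG.
  rewrite -!quotientR ?nN ?comm_subG //; exact: quotientS1.
have key: [~: 'L_j.+1(G) / N, G / N, 'L_i.+1(G) / N] = 1.
  rewrite (@three_subgroup _ [group of G / N] [group of 'L_i.+1(G) / N]
            [group of 'L_j.+1(G) / N]) //; apply: cent3; rewrite ?lcn_sub //.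
    rewrite [[~: G, _]]commGC -lcnSn (subset_trans (IHj i.+1)) //.
    by rewrite /N !addSn !addnS.
  by rewrite (subset_trans (commSg G (IHj i))) // (subset_trans (lcnSnS _ _)) // -addnS.
have nR : [~: 'L_j.+1(G), G] \subset 'N(N).
  by rewrite (subset_trans _ nNG) // comm_subG ?lcn_sub.
rewrite -quotient_sub1; last by rewrite comm_subG.
by rewrite !quotientR ?key.
Qed.

Lemma prime_power_dvd_bin p e k : prime p -> 0 < k < p -> p ^ e %| 'C(p ^ e, k).
Proof.
move=> p_pr /andP[k_gt0 ltkp].
have co : coprime (p ^ e) k by rewrite coprimeXl // prime_coprime // gtnNdvd.
by rewrite -(Gauss_dvdr _ co) -(prednK k_gt0) -mul_bin_diag dvdn_mulr.
Qed.

(** The form of the Hall-Petrescu formula needed for small class. The sequence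
    n |-> y ^- n * x ^- n * (x * y) ^+ n is polynomial for the lower central
    series, and it is trivial at 0 and 1. *)
Lemma hall_petrescu (gT : finGroupType) (H : {group gT}) p e x y :
    prime p -> 'L_p(H) = 1 -> x \in H -> y \in H ->
  exists2 v, v \in <<[set d ^+ (p ^ e)%N | d in H^`(1)]>>
           & (x * y) ^+ (p ^ e)%N = x ^+ (p ^ e)%N * y ^+ (p ^ e)%N * v.
Proof.
move=> p_pr Lp1 Hx Hy; pose F i := 'L_i(H)%G.
have F_anti i : F i.+1 \subset F i by apply: lcn_subS.
have F_comm i j : [~: F i, F j] \subset F (i + j) by apply: lcn_comm.
pose f n := (y ^+ n)^-1 * ((x ^+ n)^-1 * (x * y) ^+ n).
exists (f (p ^ e)%N); last by rewrite /f -mulgA !mulKVg.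
apply: (poly_seq_power F_anti F_comm (prime_gt1 p_pr) Lp1).
- by move=> k; apply: prime_power_dvd_bin.
- move=> k; have [PM PV _] := poly_seq_group F_anti F_comm k.
  have Pexp z : z \in H -> poly_seq F k 0 (fun n => z ^+ n).
    move=> Hz; under eq_fun do rewrite -[X in _ ^+ X]bin1.
    exact: poly_seq_binomial.
  by apply: (PM); [|apply: (PM)]; try apply: PV; apply: Pexp; rewrite ?groupM.
- by rewrite /f !expg0 !invg1 !mulg1.
by rewrite /f !expg1 mulKg mulVg.
Qed.

(** * Power maps in groups of small class *)

(** Modulo N the generators commute. The generating set may be redundant, which
    lets it contain whole subgroups whose commutators are easy to control. *)
Lemma der1_sub_gen (gT : finGroupType) (X : {set gT}) (H N : {group gT}) :
    H \subset <<X>> -> <<X>> \subset 'N(N) ->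
    {in X &, forall x y, [~ x, y] \in N} -> H^`(1) \subset N.
Proof.
move=> sHX nNX cXX; apply: subset_trans (dergS 1 sHX) _.
apply: der1_min => //; rewrite quotient_gen ?abelian_gen; last first.
  by rewrite (subset_trans (subset_gen X)).
rewrite /abelian quotient_cents2r // gen_subG; apply/subsetP=> _ /imset2P[x y Xx Xy ->].
exact: cXX.
Qed.

(** Adjoining a single element to the derived subgroup lowers the class; this is
    what the induction proving regularity runs on. *)
Lemma lcn_cycle_der (gT : finGroupType) (H : {group gT}) x j :
  x \in H -> 'L_j.+2(<[x]> <*> H^`(1)) \subset 'L_j.+3(H).
Proof.
move=> Hx; set K := _ <*> _; have sKH : K \subset H.
  by rewrite join_subG cycle_subG Hx der_sub.
elim: j => [|j IHj]; last first.
  exact: subset_trans (commSg _ IHj) (commgS _ sKH).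
apply: (@der1_sub_gen _ ([set x] :|: H^`(1))).
- by rewrite join_subG cycle_subG mem_gen ?setU11 // sub_gen ?subsetUr.
- by apply: subset_trans (lcn_norm 3 H); rewrite gen_subG subUset sub1set Hx der_sub.
have der_x y z : y \in H^`(1) -> z \in H -> [~ y, z] \in 'L_3(H).
  by move=> Hy Hz; rewrite lcnSn mem_commg.
move=> y z; rewrite !inE => /predU1P[-> | H'y] /predU1P[-> | H'z].
- by rewrite commgg group1.
- by rewrite -invg_comm groupV der_x.
- exact: der_x.
by rewrite der_x // (subsetP (der_sub 1 H)).
Qed.


(** The half of P. Hall's theory of regular p-groups that is used below. *)
Definition power_regular (gT : finGroupType) q (H : {group gT}) :=
  {in H &, forall x y, x ^+ q = y ^+ q -> (x^-1 * y) ^+ q = 1}.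

Lemma power_regular_kernel (gT : finGroupType) q (H : {group gT}) :
  power_regular q H -> group_set [set x in H | x ^+ q == 1].
Proof.
move=> regH; apply/group_setP; split=> [|x y]; first by rewrite inE group1 expg1n eqxx.
rewrite !inE => /andP[Hx /eqP xq] /andP[Hy /eqP yq]; rewrite groupM //=.
by rewrite -{1}[x]invgK regH ?groupV // expgVn xq yq invg1.
Qed.

(** x and its conjugate x ^ y have the same q-th power. *)
Lemma commg_power1 (gT : finGroupType) q (H : {group gT}) x y :
    power_regular q H -> x \in H -> x ^ y \in H -> commute (x ^+ q) y ->
  [~ x, y] ^+ q = 1.
Proof.
move=> regH Hx Hxy cxy; rewrite commgEl regH // -conjXg.
by rewrite conjgE cxy mulKg.
Qed.

(** Induction on the class, for H generated by x and y. As y commutes with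
    y ^+ q = x ^+ q, the commutator [x, y] has trivial q-th power by induction in
    <x>H'. Its conjugates generate H', so all of H' has exponent dividing q, and
    the correction term of the Hall-Petrescu formula disappears. *)
Lemma small_class_regularX (gT : finGroupType) p e (H : {group gT}) :
  prime p -> 'L_p(H) = 1 -> power_regular (p ^ e) H.
Proof.
move=> p_pr; set q := (p ^ e)%N; rewrite -(prednK (prime_gt0 p_pr)).
have: p.-1 < p by rewrite prednK ?prime_gt0.
elim: p.-1 gT H => [|c IHc] gT H ltcp Lc1 x y Hx Hy eq_xy.
  move: Hx Hy; rewrite (Lc1 : H :=: 1) => /set1P-> /set1P->.
  by rewrite mulg1 invg1 expg1n.
pose H0 := <<[set x; y]>>%G.
have sH0H : H0 \subset H by rewrite gen_subG subUset !sub1set Hx Hy.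
have {}Hx : x \in H0 by rewrite mem_gen // !inE eqxx.
have {}Hy : y \in H0 by rewrite mem_gen // !inE eqxx orbT.
have {H sH0H} Lc1 : 'L_c.+2(H0) = 1.
  by apply/trivgP; rewrite -Lc1 lcnS.
have Lp1 : 'L_p(H0) = 1.
  by apply/trivgP; rewrite -Lc1 lcn_sub_leq.
(* It remains to kill the correction term v of the Hall-Petrescu formula. *)
have [v + ->] := hall_petrescu e p_pr Lp1 (groupVr Hx) Hy.
suff H0q : {in H0^`(1), forall d, d ^+ q = 1}.
  rewrite (_ : <<_>> = 1) => [/set1P-> |].
    by rewrite expgVn eq_xy mulVg mulg1.
  apply/trivgP; rewrite gen_subG; apply/subsetP=> _ /imsetP[d H'd ->].
  by rewrite H0q ?set11.
case: c IHc ltcp Lc1 => [|c] IHc ltcp Lc1 => [d|].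
  by rewrite (Lc1 : H0^`(1) = 1) => /set1P->; rewrite expg1n.
pose K := (<[x]> <*> H0^`(1))%G.
have Kx : x \in K by rewrite (subsetP (joing_subl _ _)) ?cycle_id.
have sH'K : H0^`(1) \subset K by apply: joing_subr.
have LK1 : 'L_c.+2(K) = 1.
  by apply/trivgP; rewrite -Lc1; apply: lcn_cycle_der.
have regK := IHc _ K (ltnW ltcp) LK1.
have reg' : power_regular q H0^`(1)%G.
  by move=> d1 d2 d1H d2H; apply: regK; apply: (subsetP sH'K).
pose N := Group (power_regular_kernel reg').
suff /subsetP sH'N : H0^`(1) \subset N.
  by move=> d /sH'N; rewrite inE => /andP[_ /eqP].
have nNH : H0 \subset 'N(N).
  apply/subsetP=> h Hh; rewrite inE; apply/subsetP=> _ /imsetP[d + ->].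
  rewrite !inE => /andP[H'd /eqP dq].
  by rewrite -conjXg dq conj1g eqxx memJ_norm ?H'd // (subsetP (der_norm 1 H0)).
have Nxy : [~ x, y] \in N.
  rewrite inE mem_commg //= (commg_power1 regK) //.
    by rewrite conjg_mulR groupM // (subsetP sH'K) ?mem_commg.
  by rewrite /commute eq_xy -expgSr -expgS.
apply: (der1_sub_gen (subxx H0) nNH) => _ _ /set2P[]-> /set2P[]->.
- by rewrite commgg group1.
- exact: Nxy.
- by rewrite -invg_comm groupV.
by rewrite commgg group1.
Qed.

Lemma small_class_regular (gT : finGroupType) p (H : {group gT}) :
  prime p -> 'L_p(H) = 1 -> power_regular p H.
Proof. by move=> p_pr /(small_class_regularX (e := 1) p_pr); rewrite expn1. Qed.

Lemma power_regularS (gT : finGroupType) q (H K : {group gT}) :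
  K \subset H -> power_regular q H -> power_regular q K.
Proof. by move/subsetP=> sKH regH x y /sKH Hx /sKH Hy; apply: regH. Qed.

Lemma regular_gen_exponent (gT : finGroupType) q (X : {set gT})
    (H : {group gT}) :
    power_regular q H -> X \subset H -> {in X, forall x, x ^+ q = 1} ->
  {in <<X>>, forall x, x ^+ q = 1}.
Proof.
move=> regH sXH Xq; pose N := Group (power_regular_kernel regH).
have /subsetP sXN: <<X>> \subset N.
  by rewrite gen_subG; apply/subsetP=> x Xx; rewrite inE (subsetP sXH) ?Xq /=.
by move=> x /sXN; rewrite inE => /andP[_ /eqP].
Qed.

(** * p-groups of maximal class *)

Lemma prime_index_subgroup (gT : finGroupType) (A B C : {group gT}) :
    prime #|C : A| -> A \subset B -> B \subset C -> ~~ (B \subset A) -> B :=: C.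
Proof.
move=> prCA sAB sBC nsBA; apply/eqP; rewrite eqEsubset sBC /=.
rewrite -indexg_eq1; have prI := Lagrange_index sBC sAB; rewrite -prI in prCA.
have [_ /(_ #|C : B| (dvdn_mulr _ (dvdnn _)))/orP[//|]] := primeP prCA.
rewrite -{1}[#|C : B|]muln1 eqn_pmul2l ?indexg_gt0 // eq_sym indexg_eq1.
by rewrite (negPf nsBA).
Qed.

(** A proper subgroup fills at most a fraction 1 / p of G, so fewer than p of
    them cannot cover it. *)
Lemma p_group_avoid (gT : finGroupType) (p : nat) (G : {group gT})
    (s : seq {group gT}) :
    p.-group G -> {in s, forall M : {group gT}, M \proper G} -> size s < p ->
  exists2 x, x \in G & {in s, forall M : {group gT}, x \notin M}.
Proof.
move=> pG prM lt_s_p; pose U := [set x | has (fun M : {group gT} => x \in M) s].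
suff: #|U| * p <= size s * #|G|.
  move=> leU; case: (boolP (G \subset U)) => [sGU | /subsetPn[x Gx]].
    have := leq_trans (leq_mul (subset_leq_card sGU) (leqnn p)) leU.
    by rewrite mulnC leq_pmul2r ?cardG_gt0 // leqNgt lt_s_p.
  by rewrite inE => /hasPn xU; exists x.
rewrite /U => {lt_s_p U}; elim: s prM => [|M s IHs] prM.
  by rewrite (_ : [set x | _] = set0) ?cards0 //; apply/setP=> x; rewrite !inE.
rewrite (_ : [set x | _] =
    M :|: [set x | has (fun M : {group gT} => x \in M) s]); last first.
  by apply/setP=> x; rewrite !inE.
have [sMG neqMG] := andP (prM M (mem_head _ _)).
have pM : #|M| * p <= #|G|.
  rewrite -(Lagrange sMG) leq_mul2l orbC.
  have [k def_i] := p_natP (pnat_dvd (dvdn_indexg G M) pG).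
  rewrite def_i; case: k def_i => [/eqP|k _]; first by rewrite indexg_eq1 (negPf neqMG).
  have [->|p_gt0] := posnP p; first by rewrite exp0n.
  by rewrite expnS leq_pmulr // expn_gt0 p_gt0.
have le_s := IHs (fun L sL => prM L (mem_behead (s := M :: s) sL)).
apply: leq_trans (leq_mul (leq_card_setU _ _) (leqnn p)) _.
by rewrite mulnDl /= mulSn leq_add.
Qed.

Section TwoStepCentraliser.
Variables (gT : finGroupType) (G : {group gT}) (i : nat).

(** The centraliser in G of 'L_i(G) / 'L_i.+2(G). In the classical theory of
    maximal class the case i = 2 is the fundamental maximal subgroup, and the
    uniserial elements are those outside these subgroups for 2 <= i <= n - 2, when
    |G| = p ^ n. *)
Definition two_step_cent :=
  [set g in G | [forall y in 'L_i(G), [~ y, g] \in 'L_i.+2(G)]].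

Lemma two_step_centP g :
  reflect (g \in G /\ {in 'L_i(G), forall y, [~ y, g] \in 'L_i.+2(G)})
          (g \in two_step_cent).
Proof. by rewrite inE; apply: (iffP andP) => [] [Gg /forall_inP]. Qed.

Lemma two_step_cent_group_set : group_set two_step_cent.
Proof.
apply/group_setP; split=> [|g h].
  by apply/two_step_centP; split=> // y _; rewrite commg1.
move=> /two_step_centP[Gg cg] /two_step_centP[Gh ch].
apply/two_step_centP; split=> [|y Ly]; first exact: groupM.
by rewrite commgMJ groupM ?ch // memJ_norm ?cg // (subsetP (lcn_norm _ _)).
Qed.
Canonical two_step_cent_group := Group two_step_cent_group_set.

Lemma two_step_cent_proper :
  0 < i -> ~~ ('L_i.+1(G) \subset 'L_i.+2(G)) -> two_step_cent \proper G.
Proof.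
move=> i_gt0; apply: contraR; rewrite properE => /nandP[/subsetPn[g]|].
  by case/two_step_centP=> ->.
rewrite negbK => /subsetP sGC.
rewrite -{1}(prednK i_gt0) lcnSn prednK // gen_subG.
by apply/subsetP=> _ /imset2P[y g Ly /sGC/two_step_centP[_ cg] ->]; apply: cg.
Qed.

(** When 'L_i(G) / 'L_i.+1(G) has prime order, any element outside 'L_i.+1(G)
    generates it, so centralising one such element modulo 'L_i.+2(G) is
    centralising everything. *)
Lemma two_step_centW g y :
    0 < i -> prime #|'L_i(G) : 'L_i.+1(G)| ->
    g \in G -> y \in 'L_i(G) -> y \notin 'L_i.+1(G) -> [~ y, g] \in 'L_i.+2(G) ->
  g \in two_step_cent.
Proof.
move=> i_gt0 pr_i Gg Ly nLy cyg; have nLG := lcn_norm i.+2 G.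
have nLL := subset_trans (lcn_sub i G) nLG.
pose T := [set z in 'L_i(G) | [~ z, g] \in 'L_i.+2(G)].
have gsT : group_set T.
  apply/group_setP; split=> [|z w]; first by rewrite inE group1 comm1g group1.
  rewrite !inE => /andP[Lz cz] /andP[Lw cw].
  by rewrite groupM // commMgJ groupM // memJ_norm // (subsetP nLL).
have defT : Group gsT :=: 'L_i(G).
  apply: (@prime_index_subgroup _ 'L_i.+1(G)%G) => //=.
  - apply/subsetP=> z Lz; rewrite inE (subsetP (lcn_subS i G)) //=.
    by rewrite -(prednK i_gt0) lcnSn mem_commg // prednK.
  - by apply/subsetP=> z; rewrite inE => /andP[].
  - by apply/subsetPn; exists y; rewrite // inE Ly.
apply/two_step_centP; split=> // z; rewrite -defT inE.
by case/andP.
Qed.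

End TwoStepCentraliser.

Section MaximalClass.
Variables (gT : finGroupType) (p n : nat) (G : {group gT}).
Hypotheses (p_pr : prime p) (n_gt2 : 2 < n).
Hypotheses (oG : #|G| = (p ^ n)%N) (clG : nil_class G = n.-1).

Let pG : p.-group G.
Proof. by rewrite /pgroup oG pnatX pnat_id. Qed.

Let nilG : nilpotent G. Proof. exact: pgroup_nil pG. Qed.

Lemma mc_lcn1 : 'L_n(G) = 1.
Proof.
rewrite -(prednK (ltnW (ltnW n_gt2))).
by apply/(lcn_nil_classP _ nilG); rewrite clG leqnn.
Qed.

Lemma mc_lcn_neq1 i : 0 < i < n -> 'L_i(G) != 1.
Proof.
case: i => // i ltin; apply/eqP=> /(lcn_nil_classP _ nilG).
by rewrite clG; lia.
Qed.

Lemma mc_lcn_properS i : 0 < i < n -> 'L_i.+1(G) \proper 'L_i(G).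
Proof.
move=> i_n; have := mc_lcn_neq1 i_n; case: i i_n => // i _ ntL.
rewrite lcnSn; apply: (nil_comm_properl nilG) => //; first exact: lcn_sub.
by rewrite subsetI subxx lcn_norm.
Qed.

Lemma mc_quo_der1_ncyclic : ~~ cyclic (G / G^`(1)).
Proof.
apply/negP=> /(cyclic_nilpotent_quo_der1_cyclic nilG)/cyclic_abelian.
by rewrite -nil_class1 clG; apply/negP; rewrite -ltnNge -ltnS prednK // 2?ltnW.
Qed.

Lemma mc_index_der1 : p ^ 2 %| #|G : G^`(1)|.
Proof.
have [k def_k] := p_natP (pnat_dvd (dvdn_indexg G G^`(1)) pG).
rewrite def_k; apply: dvdn_exp2l; rewrite ltnNge.
apply: contra mc_quo_der1_ncyclic => lek1.
have oQ : #|G / G^`(1)| = (p ^ k)%N by rewrite card_quotient ?der_norm.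
case: k lek1 oQ {def_k} => [|[]] // _ oQ; last by rewrite prime_cyclic ?oQ.
by rewrite (card1_trivg oQ) cyclic1.
Qed.

(** There are n - 1 strict inclusions in the lower central series and the first
    factor has order at least p ^ 2, so |G| = p ^ n leaves no room for any
    factor to be larger. *)
Lemma mc_card_lcn i : 1 < i <= n -> #|'L_i(G)| = (p ^ (n - i))%N.
Proof.
have p_gt0 := prime_gt0 p_pr; have p_gt1 := prime_gt1 p_pr.
have pL j : {k | #|'L_j(G)| = (p ^ k)%N}.
  exact: p_natP (pgroupS (lcn_sub j G) pG).
pose l j := sval (pL j); have lE j : #|'L_j(G)| = (p ^ l j)%N := svalP (pL j).
have l_dec j : 0 < j < n -> l j.+1 < l j.
  by move/mc_lcn_properS/proper_card; rewrite !lE ltn_exp2l.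
have ln0 : l n = 0%N.
  by apply/eqP; rewrite -(eqn_exp2l _ _ p_gt1) -lE mc_lcn1 cards1.
have l_add j k : 0 < j -> j + k <= n -> l (j + k) + k <= l j.
  elim: k => [|k IHk] j_gt0 lejk; first by rewrite !addn0.
  rewrite addnS in lejk *; rewrite addnS -addSn.
  apply: leq_trans (IHk j_gt0 (ltnW lejk)); rewrite leq_add2r.
  by apply: l_dec; rewrite lejk addn_gt0 j_gt0.
have l2 : l 2 <= n - 2.
  have := dvdn_mul (dvdnn #|G^`(1)|) mc_index_der1.
  rewrite Lagrange ?der_sub // oG -lcn2 lE -expnD => /dvdn_leq.
  rewrite expn_gt0 p_gt0 leq_exp2l // => /(_ isT).
  by rewrite -[_ <= n - 2](leq_add2r 2) subnK // ltnW.
move=> /andP[i_gt1 lein]; rewrite lE; congr (p ^ _)%N; apply/eqP.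
rewrite eqn_leq; apply/andP; split.
  have := l_add 2 (i - 2) isT; rewrite subnKC // => /(_ lein).
  move/leq_trans/(_ l2); move: (l i) => k; clear -i_gt1 lein; lia.
have := l_add i (n - i) (ltnW i_gt1); rewrite subnKC // ln0.
exact.
Qed.

Lemma mc_index_lcn i : 1 < i < n -> #|'L_i(G) : 'L_i.+1(G)| = p.
Proof.
move=> /andP[i_gt1 ltin]; have := Lagrange (lcn_subS i G).
rewrite (@mc_card_lcn i) ?i_gt1 ?(ltnW ltin) //.
rewrite (@mc_card_lcn i.+1) ?ltnS ?(ltnW i_gt1) //.
rewrite -(subnSK ltin) expnSr => /eqP.
by rewrite eqn_pmul2l ?expn_gt0 ?prime_gt0 // => /eqP.
Qed.

Lemma mc_card_quo_der1 : #|G : G^`(1)| = (p ^ 2)%N.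
Proof.
have: (#|'L_2(G)| * #|G : G^`(1)|)%N = #|G| by apply: Lagrange (der_sub 1 G).
rewrite oG mc_card_lcn ?(ltnW n_gt2) //.
rewrite -{2}(subnK (ltnW n_gt2)) expnD => /eqP.
by rewrite eqn_pmul2l ?expn_gt0 ?prime_gt0 // => /eqP.
Qed.

Lemma mc_power_der1 x : x \in G -> x ^+ p \in 'L_2(G).
Proof.
move=> Gx; have nLx : x \in 'N('L_2(G)) by rewrite (subsetP (lcn_norm 2 G)).
apply: coset_idr; rewrite ?groupX // morphX //.
have oQ : #|G / 'L_2(G)| = (p ^ 2)%N.
  by rewrite card_quotient ?lcn_norm ?mc_card_quo_der1.
have Qx := mem_quotient 'L_2(G) Gx; have := order_dvdG Qx.
rewrite oQ => /(dvdn_pfactor _ _ p_pr)[k lek2 ox].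
apply/eqP; rewrite -order_dvdn ox -{2}(expn1 p) dvdn_exp2l //.
rewrite -ltnS ltn_neqAle lek2 andbT; apply: contra mc_quo_der1_ncyclic => /eqP k2.
apply/cyclicP; exists (coset 'L_2(G) x); apply/esym/eqP.
by rewrite eqEcard cycle_subG Qx /= oQ -/(order _) ox k2.
Qed.

(** A uniserial s has its p-th power in G', and s ^+ p commutes with s; since s
    commutes with no element of G' outside 'L_n.-1(G), that is where s ^+ p lies.
    There are n - 3 < p - 1 subgroups to avoid, so by counting the uniserial
    elements lie in no proper subgroup and generate G. Finally G / 'L_n.-1(G)
    is regular, so having exponent p can be checked on generators. *)
Lemma mc_power x : n <= p.+1 -> x \in G -> x ^+ p \in 'L_n.-1(G).
Proof.
move=> len Gx; pose N := ('L_n.-1(G))%G.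
have n_gt0 : 0 < n by rewrite ltnW // ltnW.
pose S := [set s in G | [forall i : 'I_(n - 3), s \notin two_step_cent G (i + 2)]].
have SP s : s \in S -> s \in G /\ s ^+ p \in N.
  rewrite inE => /andP[Gs /forallP uni_s]; split=> //.
  suff Lk k : k + 2 < n -> s ^+ p \in 'L_(k + 2)(G).
    have := Lk (n - 3); rewrite /N /= (_ : n - 3 + 2 = n.-1); last by lia.
    by apply; lia.
  elim: k => [|k IHk] ltk; first exact: mc_power_der1.
  have k2n : k + 2 < n by lia.
  have lt_k : k < n - 3 by lia.
  (* s commutes with s ^+ p, so s ^+ p cannot lie outside the next term. *)
  have := uni_s (Ordinal lt_k); apply: contraR => nLs.
  apply: (two_step_centW _ _ Gs (IHk k2n)) => //.
  - by rewrite addnS.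
  - by rewrite mc_index_lcn // k2n addn2.
  - suff /commgP/eqP->: commute (s ^+ p) s by apply: group1.
    by apply/commute_sym/commuteX.
have genS : <<S>> = G.
  apply/eqP; rewrite eqEproper gen_subG; apply/andP; split.
    by apply/subsetP=> s /SP[].
  apply/negP=> prS.
  have [||s Gs avoid] := @p_group_avoid _ p G
    (<<S>>%G :: [seq two_step_cent_group G (i + 2) | i <- iota 0 (n - 3)]) pG.
  - move=> M; rewrite inE => /predU1P[-> // | /mapP[i]].
    rewrite mem_iota => /andP[_ lti] ->; apply: two_step_cent_proper.
      by rewrite addnS.
    apply: proper_subn; apply: mc_lcn_properS; lia.
  - by rewrite /= size_map size_iota; lia.
  have: s \in <<S>>.
    apply: mem_gen; rewrite inE Gs; apply/forallP=> i.
    apply: (avoid (two_step_cent_group G (i + 2))).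
    rewrite inE (map_f (fun i => two_step_cent_group G (i + 2))) ?orbT //.
    by rewrite mem_iota /=.
  by apply/negP; apply: (avoid <<S>>%G); rewrite mem_head.
have nNG : G \subset 'N(N) by apply: lcn_norm.
have regQ : power_regular p (G / N)%G.
  apply: small_class_regular => //=.
  have L1 : 'L_n.-1(G / N) = 1.
    by rewrite -morphim_lcn // -quotientE quotientS1.
  by apply/trivgP; rewrite -L1 lcn_sub_leq // -ltnS prednK.
have sSN : S \subset 'N(N) by apply: subset_trans nNG; apply/subsetP=> s /SP[].
have Qgen : G / N = <<S / N>> by rewrite -quotient_gen // genS.
apply: coset_idr; first by rewrite groupX // (subsetP nNG).
rewrite morphX ?(subsetP nNG) //.
apply: (regular_gen_exponent regQ (X := S / N)).
- by apply: quotientS; apply/subsetP=> s /SP[].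
- move=> _ /morphimP[s Ns /SP[_ sp] ->].
  by rewrite -morphX //; apply: coset_id.
by have := mem_quotient N Gx; rewrite Qgen.
Qed.

End MaximalClass.

Section MaximalClassGenerators.
Variables (gT : finGroupType) (p n : nat) (G : {group gT}).
Hypotheses (p_pr : prime p) (n_gt3 : 3 < n).
Hypotheses (oG : #|G| = (p ^ n)%N) (clG : nil_class G = n.-1).

Let n_gt2 : 2 < n. Proof. exact: ltnW. Qed.

(** Let y generate 'L_2(G) modulo 'L_3(G). In G / 'L_4(G), of order p ^ 4, the
    class of y lies in one coset of the subgroup 'L_3(G) / 'L_4(G) of order p, so
    the centraliser of y has order at least p ^ 3 and is larger than the derived
    subgroup. *)
Lemma mc_two_step_cent_large : ~~ (two_step_cent G 2 \subset G^`(1)).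
Proof.
pose N := 'L_4(G)%G; have nNG : G \subset 'N(N) by apply: lcn_norm.
have nN i : 'L_i(G) \subset 'N(N) by apply: subset_trans (lcn_sub i G) nNG.
have oL2 : #|'L_2(G) : 'L_3(G)| = p by apply: (mc_index_lcn p_pr n_gt2 oG clG).
have oL3 : #|'L_3(G) : N| = p by apply: (mc_index_lcn p_pr n_gt2 oG clG).
have oL2N : #|'L_2(G) : N| = (p ^ 2)%N.
  by rewrite -(Lagrange_index (lcn_subS 2 G) (lcn_subS 3 G)) oL2 oL3.
have oQ : #|G : N| = (p ^ 4)%N.
  rewrite -(Lagrange_index (lcn_sub 2 G) (lcn_sub_leq G (isT : 2 <= 4))) oL2N.
  by rewrite (mc_card_quo_der1 p_pr n_gt2 oG clG) -expnD.
have /properP[_ [y Ly nLy]] : 'L_3(G) \proper 'L_2(G).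
  exact: (mc_lcn_properS p_pr n_gt2 oG clG).
have Gy : y \in G by apply: subsetP (lcn_sub 2 G) _ Ly.
pose yb := coset N y.
have idx : #|G / N : 'C_(G / N)[yb]| <= p.
  rewrite index_cent1 -oL3 -card_quotient // -(card_lcoset ('L_3(G) / N) yb).
  apply/subset_leq_card/subsetP=> _ /imsetP[_ /morphimP[z nNz Gz ->] ->].
  rewrite conjg_mulR mem_lcoset mulKg -morphR ?(subsetP nNG) //.
  by apply: mem_quotient; apply: mem_commg.
have /subsetPn[_ /setIP[/morphimP[z nNz Gz ->] /cent1P cyz] nQz] :
    ~~ ('C_(G / N)[yb] \subset 'L_2(G) / N).
  apply/negP=> /subset_leq_card; rewrite card_quotient // oL2N => leC.
  have := Lagrange (subsetIl (G / N) 'C[yb]); rewrite card_quotient // oQ => oC.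
  have := leq_mul leC idx; rewrite oC -expnSr leq_exp2l //.
  exact: prime_gt1.
apply/subsetPn; exists z; last by apply: contra nQz; apply: mem_quotient.
apply: (two_step_centW _ _ Gz Ly nLy) => //; first by rewrite oL2.
apply: coset_idr; first by rewrite groupR // (subsetP nNG).
by rewrite morphR ?(subsetP nNG) //; apply/eqP/commgP.
Qed.

Lemma mc_generators : exists x s,
  [/\ x \in two_step_cent G 2, s \in G & G \subset <<[set x; s] :|: G^`(1)>>].
Proof.
have /subsetPn[x Cx nG'x] := mc_two_step_cent_large.
have /two_step_centP[Gx _] := Cx.
pose M := (<[x]> <*> G^`(1))%G.
have sMG : M \subset G by rewrite join_subG cycle_subG Gx der_sub.
have sG'M : G^`(1) \subset M by apply: joing_subr.
have Mx : x \in M by rewrite (subsetP (joing_subl _ _)) ?cycle_id.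
have sMX s : M \subset <<[set x; s] :|: G^`(1)>>.
  rewrite join_subG cycle_subG mem_gen ?inE ?eqxx //=.
  by rewrite sub_gen // subsetUr.
case: (boolP (G \subset M)) => [sGM | nsGM].
  by exists x, 1; split; rewrite ?group1 ?(subset_trans sGM).
have [s Gs nMs] := subsetPn nsGM; exists x, s; split=> //.
have prM : prime #|G : M|.
  have := Lagrange_index sMG sG'M; rewrite (mc_card_quo_der1 p_pr n_gt2 oG clG) => oGM.
  have /(dvdn_pfactor _ _ p_pr)[k lek2 oM] : #|G : M| %| p ^ 2.
    by rewrite -oGM dvdn_mulr.
  rewrite oM; case: k lek2 oM => [|[|[|]]] // _ oM.
    by case/negP: nsGM; rewrite -indexg_eq1 oM.
  have: #|M : G^`(1)| == 1%N.
    rewrite -(eqn_pmul2l (indexg_gt0 G M)) muln1 oM in oGM *.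
    by rewrite oGM.
  by rewrite indexg_eq1 => /subsetP/(_ x Mx); rewrite (negPf nG'x).
have defG : (M <*> <[s]>)%G :=: G.
  apply: (prime_index_subgroup prM); first exact: joing_subl.
    by rewrite join_subG sMG cycle_subG.
  by rewrite join_subG negb_and cycle_subG nMs orbT.
apply: (@subset_trans _ _ (M <*> <[s]>)); first by rewrite -defG.
by rewrite join_subG sMX cycle_subG mem_gen // !inE eqxx orbT.
Qed.

Section Exponent.
Variables x s : gT.
Hypotheses (Cx : x \in two_step_cent G 2) (Gs : s \in G).
Hypothesis genG : G \subset <<[set x; s] :|: G^`(1)>>.
Let M := (<[x]> <*> G^`(1))%G.

Let Gx : x \in G. Proof. by case/two_step_centP: Cx. Qed.
Let sMG : M \subset G.
Proof. by rewrite join_subG cycle_subG Gx der_sub. Qed.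

(** By the choice of x, and since [G', G'] lies in 'L_4(G) for every group G, the
    generators of M commute modulo 'L_4(G). *)
Lemma mc_der1_maximal : M^`(1) \subset 'L_4(G).
Proof.
apply: (@der1_sub_gen _ ([set x] :|: G^`(1))).
- by rewrite join_subG cycle_subG mem_gen ?setU11 // sub_gen ?subsetUr.
- by apply: subset_trans (lcn_norm 4 G); rewrite gen_subG subUset sub1set Gx der_sub.
have /two_step_centP[_ cx] := Cx.
move=> y z; rewrite !inE => /predU1P[-> | H'y] /predU1P[-> | H'z].
- by rewrite commgg group1.
- by rewrite -invg_comm groupV cx.
- exact: cx.
by rewrite (subsetP (lcn_comm G 2 2)) // mem_commg.
Qed.

(** For u in M the power u ^+ p is central, so [u, g] ^+ p = 1 by regularity of
    M. Such commutators generate G' because G is generated by M and one further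
    element. *)
Lemma mc_der1_exponent : n <= p.+1 -> 'L_p(M) = 1 ->
  {in G^`(1), forall d, d ^+ p = 1}.
Proof.
move=> len Lp1; have regM := small_class_regular p_pr Lp1.
have sG'M : G^`(1) \subset M by apply: joing_subr.
have comm_p u g : u \in M -> g \in G -> [~ u, g] ^+ p = 1.
  move=> Mu Gg; have Gu := subsetP sMG u Mu.
  apply: (commg_power1 regM Mu).
    by rewrite conjg_mulR groupM // (subsetP sG'M) ?mem_commg.
  apply/commgP/eqP.
  suff: [~ u ^+ p, g] \in 'L_n(G) by rewrite (mc_lcn1 p_pr n_gt2 oG clG) => /set1P.
  have n1_gt0 : 0 < n.-1 by rewrite -subn1 subn_gt0 ltnW.
  rewrite -(prednK (ltnW (ltnW n_gt2))) -(prednK n1_gt0) lcnSn prednK //.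
  by rewrite mem_commg // (mc_power p_pr n_gt2 oG clG).
have reg' := power_regularS sG'M regM.
pose N := Group (power_regular_kernel reg').
suff /subsetP sN : G^`(1) \subset N.
  by move=> d /sN; rewrite inE => /andP[_ /eqP].
have Np d : d \in G^`(1) -> d ^+ p = 1 -> d \in N.
  by move=> G'd dp; rewrite inE G'd dp /=.
apply: (der1_sub_gen genG).
  apply: (@subset_trans _ _ G); last first.
    apply/subsetP=> h Hh; rewrite inE; apply/subsetP=> _ /imsetP[d + ->].
    rewrite !inE => /andP[H'd /eqP dq].
    by rewrite -conjXg dq conj1g eqxx memJ_norm ?H'd // (subsetP (der_norm 1 G)).
  by rewrite gen_subG !subUset !sub1set Gx Gs der_sub.
have XP u : u \in [set x; s] :|: G^`(1) -> (u \in M) || (u == s).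
  rewrite !inE => /orP[/orP[/eqP->|->]|G'u]; rewrite ?orbT //.
    by rewrite (subsetP (joing_subl _ _)) ?cycle_id.
  by rewrite (subsetP sG'M).
move=> u v /XP Xu /XP Xv.
have [Gu Gv] : u \in G /\ v \in G.
  by split; [move: Xu | move: Xv]; case/orP=> [/(subsetP sMG)|/eqP->].
case/orP: Xu => [Mu | /eqP->]; first by apply: Np (comm_p _ _ _ _); rewrite ?mem_commg.
case/orP: Xv => [Mv | /eqP->]; last by rewrite commgg group1.
by rewrite -invg_comm groupV; apply: Np (comm_p _ _ _ _); rewrite ?mem_commg.
Qed.

End Exponent.
End MaximalClassGenerators.

(** * Central extensions of a group of maximal class *)

Section CentralExtension.
Variables (gT : finGroupType) (p n : nat) (E A : {group gT}).
Hypotheses (p_pr : prime p) (p_gt2 : 2 < p) (n_gt3 : 3 < n) (len : n <= p.+1).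
Hypothesis sAZ : A \subset 'Z(E).
Hypotheses (oG : #|E / A| = (p ^ n)%N) (clG : nil_class (E / A) = n.-1).

Let n_gt2 : 2 < n. Proof. exact: ltnW. Qed.
Let sAE : A \subset E. Proof. exact: subset_trans (center_sub E). Qed.
Let cAE : E \subset 'C(A).
Proof. by rewrite centsC (subset_trans sAZ) ?subsetIr. Qed.
Let nAE : E \subset 'N(A). Proof. exact: cents_norm cAE. Qed.
Let nA i : 'L_i(E) \subset 'N(A).
Proof. exact: subset_trans (lcn_sub i E) nAE. Qed.
Let qL i : 'L_i(E) / A = 'L_i(E / A).
Proof. by rewrite -morphim_lcn. Qed.

Let qLin i u : u \in 'L_i(E) -> coset A u \in 'L_i(E / A).
Proof. by move=> Lu; rewrite -qL mem_quotient. Qed.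

Lemma central_ext_lcn1 : 'L_n.+1(E) = 1.
Proof.
have sLA : 'L_n(E) \subset A.
  by rewrite -quotient_sub1 // qL (mc_lcn1 p_pr n_gt2 oG clG).
rewrite -(prednK (ltnW (ltnW n_gt2))) lcnSn prednK ?(ltnW (ltnW n_gt2)) //.
by apply/commG1P; rewrite (subset_trans sLA) // centsC.
Qed.

(** The preimage K in E of the maximal subgroup has its derived subgroup in
    'L_4(E)A, one step deeper than for an arbitrary maximal subgroup, so its class
    is at most n - 2. This is below p, although E itself may have class p + 1. *)
Lemma central_ext_maximal_class x :
    x \in E -> coset A x \in two_step_cent (E / A) 2 ->
  'L_p(<[x]> <*> (E^`(1) <*> A)) = 1.
Proof.
move=> Ex Cx; pose K := (<[x]> <*> (E^`(1) <*> A))%G.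
have sKE : K \subset E by rewrite !join_subG cycle_subG Ex der_sub.
have nAK := subset_trans sKE nAE.
have qK : K / A = <[coset A x]> <*> (E / A)^`(1).
  have nAx := subsetP nAE x Ex; have nAE' := subset_trans (der_sub 1 E) nAE.
  rewrite quotientY ?cycle_subG ?join_subG ?nAE' ?normG //.
  rewrite quotientY ?normG // quotient_cycle // trivg_quotient joingG1.
  by rewrite -(quotient_der 1 nAE).
have sK' : K^`(1) \subset A * 'L_4(E).
  rewrite -quotientSK ?(subset_trans (der_sub 1 K)) // qL quotient_der // qK.
  exact: mc_der1_maximal.
have LK j : 'L_j.+3(K) \subset 'L_j.+4.+1(E).
  elim: j => [|j IHj]; last exact: subset_trans (commSg _ IHj) (commgS _ sKE).
  apply: subset_trans (commSg _ sK') _; apply: subset_trans (commgS _ sKE) _.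
  have nAL : E \subset 'N([~: A, E]) by rewrite commg_normr.
  rewrite commMG ?(subset_trans (lcn_sub 4 E)) //.
  by rewrite (commG1P _) ?mul1g // centsC.
apply/trivgP; rewrite -central_ext_lcn1 -(subnKC p_gt2).
apply: subset_trans (LK _) _; apply: lcn_sub_leq.
lia.
Qed.

(** Write c = [x, s]. Three facts are combined. First, p-th powers of elements of
    E' are central, because (E / A)' has exponent p; so by regularity of K
    every [d, g] with d in E' has order dividing p, and 'L_3(E) has exponent p.
    Secondly, x ^+ (p ^ 2) is central, so c ^+ (p ^ 2) = 1, again by regularity.
    Thirdly, E' = <c> 'L_3(E). An element of E' that lies in A is thus
    c ^+ k * t with t in 'L_3(E); here p divides k, as otherwise (E / A)' would
    equal 'L_3(E / A), and the p-th power is trivial. *)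
Theorem central_ext_exponent w : w \in E^`(1) -> w \in A -> w ^+ p = 1.
Proof.
have [xb [sb [Cxb Gsb genG]]] := mc_generators p_pr n_gt3 oG clG.
have /two_step_centP[/morphimP[x nAx Ex def_x] _] := Cxb.
have /morphimP[s nAs Es def_s] := Gsb; rewrite /= in def_x def_s.
rewrite {xb}def_x {sb}def_s in Cxb Gsb genG.
pose K := (<[x]> <*> (E^`(1) <*> A))%G.
have sKE : K \subset E by rewrite !join_subG cycle_subG Ex der_sub.
have nAK := subset_trans sKE nAE.
have LpK : 'L_p(K) = 1 by apply: central_ext_maximal_class.
have regK : power_regular p K by apply: small_class_regular.
have Kx : x \in K by rewrite (subsetP (joing_subl _ _)) ?cycle_id.
have sE'K : E^`(1) \subset K.
  exact: subset_trans (joing_subl _ A) (joing_subr _ _).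
have KJ u g : u \in K -> g \in E -> u ^ g \in K.
  move=> Ku Eg; rewrite conjg_mulR groupM // (subsetP sE'K) //.
  by rewrite mem_commg // (subsetP sKE).
have cA a g : a \in A -> g \in E -> commute a g.
  by move=> Aa Eg; apply/commute_sym/(centP (subsetP cAE g Eg)).
have Gp : {in (E / A)^`(1), forall d, d ^+ p = 1}.
  apply: (mc_der1_exponent p_pr n_gt3 oG clG Cxb Gsb genG len).
  have LpQ : 'L_p(K / A) = 1 by rewrite -morphim_lcn // [X in _ @* X]LpK morphim1.
  apply/trivgP; rewrite -LpQ; apply: lcnS.
  rewrite join_subG cycle_subG mem_quotient //=.
  by rewrite -quotient_der // quotientS.
have E'p d : d \in E^`(1) -> d ^+ p \in A.
  move=> E'd; have Ed := subsetP (der_sub 1 E) d E'd; have nAd := subsetP nAE d Ed.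
  apply: coset_idr; rewrite ?groupX // morphX //; apply: Gp.
  by rewrite -quotient_der // mem_quotient.
have L3p : {in 'L_3(E), forall d, d ^+ p = 1}.
  have sXK : commg_set E^`(1) E \subset K.
    apply/subsetP=> _ /imset2P[y g E'y Eg ->].
    by rewrite commgEl groupM ?groupV ?KJ // (subsetP sE'K).
  move=> d Ld; apply: (regular_gen_exponent regK sXK _ Ld).
  move=> _ /imset2P[y g E'y Eg ->]; have Ky := subsetP sE'K y E'y.
  apply: (commg_power1 regK); rewrite ?KJ //.
  exact: cA (E'p y E'y) Eg.
pose c := [~ x, s]; have E'c : c \in E^`(1) by rewrite mem_commg.
have cpp : c ^+ (p ^ 2) = 1.
  apply: (commg_power1 (small_class_regularX (e := 2) p_pr LpK)); rewrite ?KJ //.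
  apply: cA => //.
  apply: coset_idr; first by rewrite groupX.
  rewrite morphX // expgM; apply: Gp.
  apply: subsetP (mc_power p_pr n_gt2 oG clG len (mem_quotient A Ex)).
  by apply: (@lcn_sub_leq _ _ 2); rewrite -ltnS prednK // (ltnW (ltnW n_gt2)).
pose N := (<[c]> <*> 'L_3(E))%G.
have sE'N : E^`(1) \subset N.
  have sNE : N \subset E^`(1).
    by rewrite join_subG cycle_subG E'c; apply: (lcn_subS 2 E).
  have nNE : E \subset 'N(N).
    rewrite -commg_subl; apply: subset_trans (commSg _ sNE) _.
    exact: joing_subr.
  have sXE : [set x; s] :|: (E^`(1) :|: A) \subset E.
    by rewrite !subUset !sub1set Ex Es der_sub.
  apply: (@der1_sub_gen _ ([set x; s] :|: (E^`(1) :|: A))).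
  - have sAX : A \subset <<[set x; s] :|: (E^`(1) :|: A)>>.
      by rewrite sub_gen // setUA subsetUr.
    rewrite -(quotientSGK nAE sAX); apply: subset_trans genG _.
    rewrite gen_subG !subUset !sub1set !mem_quotient ?mem_gen ?inE ?eqxx ?orbT //=.
    by rewrite -quotient_der // quotientS // sub_gen // setUCA subsetUl.
  - by apply: subset_trans nNE; rewrite gen_subG.
  have L3N d g : d \in E^`(1) -> g \in E -> [~ d, g] \in N.
    move=> E'd Eg; apply: (subsetP (joing_subr _ _)); exact: mem_commg.
  have XP u : u \in [set x; s] :|: (E^`(1) :|: A) ->
      u \in [set x; s] \/ (forall g, g \in E -> [~ u, g] \in N).
    case/setUP=> [Iu | /setUP[E'u | Au]]; [by left | right=> g Eg | right=> g Eg].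
      exact: L3N.
    by have /commgP/eqP-> := cA u g Au Eg; apply: group1.
  have Nc : c \in N by rewrite (subsetP (joing_subl _ _)) ?cycle_id.
  move=> u v Xu Xv; have [Eu Ev] := (subsetP sXE u Xu, subsetP sXE v Xv).
  have [Iu|] := XP u Xu; last exact.
  have [Iv|cv] := XP v Xv; last by rewrite -invg_comm groupV cv.
  case/set2P: Iu => ->; case/set2P: Iv => ->; rewrite ?commgg ?group1 //.
  by rewrite -invg_comm groupV.
move=> /(subsetP sE'N); rewrite /= norm_joinEl; last first.
  by apply: subset_trans (lcn_norm 3 E); rewrite cycle_subG (subsetP (der_sub 1 E)).
case/mulsgP=> _ t /cycleP[k ->] Lt -> Aw.
have nAc := subsetP (nA 2) c E'c; have nAt := subsetP (nA 3) t Lt.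
have /dvdnP[j def_k] : p %| k.
  apply/idPn=> npk; have G'c : coset A c \in 'L_2(E / A) by apply: qLin.
  have cp1 := Gp _ G'c.
  have co_ck : coprime #[coset A c] k.
    apply: coprime_dvdl (_ : #[coset A c] %| p) _; first by rewrite order_dvdn cp1.
    by rewrite prime_coprime.
  have L3c : coset A c \in 'L_3(E / A).
    have /eqP gen_ck : generator <[coset A c]> (coset A c ^+ k).
      by rewrite generator_coprime.
    rewrite -cycle_subG gen_ck cycle_subG -morphX //.
    have -> : c ^+ k = (c ^+ k * t) * t^-1 by rewrite mulgK.
    rewrite morphM ?groupM ?groupX ?groupV //=; first by rewrite (coset_id Aw) group1.
    by apply: qLin; rewrite groupV.
  have /proper_subn/negP[] : 'L_3(E / A) \proper 'L_2(E / A).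
    exact: (mc_lcn_properS p_pr n_gt2 oG clG).
  apply: (@subset_trans _ _ ('L_2(E) / A)); first by rewrite qL.
  apply: subset_trans (quotientS A sE'N) _.
  rewrite quotientY // ?cycle_subG // quotient_cycle // join_subG cycle_subG L3c.
  by have /eqP := qL 3; rewrite eqEsubset => /andP[].
have cpc : c ^+ p \in A by apply: E'p.
rewrite def_k mulnC expgM expgMn; last first.
  by apply: cA (groupX j cpc) (subsetP (lcn_sub 3 E) t Lt).
by rewrite (expgAC (c ^+ p)) -(expgM c p p) mulnn cpp expg1n mul1g L3p.
Qed.

End CentralExtension.

(** * Central extensions defined by cocycles *)

Import GRing.Theory.

Section FreeAbelian.
Local Open Scope ring_scope.
Variable X : finType.

Lemma free_ind (P : {ffun X -> int} -> Prop) :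
    P 0 -> (forall a b, P a -> P b -> P (a - b)) -> (forall x, P (free_gen x)) ->
  forall c, P c.
Proof.
move=> P0 PB Pgen c.
have PN a : P a -> P (- a) by rewrite -(sub0r a); apply: PB.
have PD a b : P a -> P b -> P (a + b).
  by move=> Pa /PN; rewrite -{2}(opprK b); apply: PB.
have Pn a k : P a -> P (a *+ k).
  by move=> Pa; elim: k => [|k IHk]; rewrite ?mulr0n // mulrS; apply: PD.
rewrite (_ : c = \sum_x free_gen x *~ c x); last first.
  apply/ffunP=> y; rewrite sum_ffunE (bigD1 y) //= ffunMzE ffunE eqxx.
  rewrite big1 ?addr0 ?intz // => x; rewrite eq_sym => /negPf neq_yx.
  by rewrite ffunMzE ffunE neq_yx mul0rz.
apply: (big_ind P) => // x _; case: (c x) => k; first exact: Pn.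
by rewrite NegzE mulrNz; apply: PN; apply: Pn.
Qed.

Variables (V : zmodType) (v : X -> V).

Definition free_lift (c : {ffun X -> int}) : V := \sum_x v x *~ c x.

Lemma free_lift_morph : zmod_morphism free_lift.
Proof.
move=> a b; rewrite /free_lift -sumrB; apply: eq_bigr => x _.
by rewrite !ffunE mulrzBr.
Qed.

Lemma free_lift_gen x : free_lift (free_gen x) = v x.
Proof.
rewrite /free_lift (bigD1 x) //= ffunE eqxx mulr1z big1 ?addr0 // => y neq_yx.
by rewrite ffunE (negPf neq_yx) mulr0z.
Qed.

End FreeAbelian.

Section AbelianZmodule.
Variable gT : finGroupType.
(** An abelian multiplicative group seen additively, so that it can be the target
    of free_lift. *)
Definition group_zmod (cG : commutative (fun x y : gT => x * y)) : Type := gT.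
Variable cG : commutative (fun x y : gT => x * y).
HB.instance Definition _ := Finite.on (group_zmod cG).
HB.instance Definition _ :=
  GRing.isZmodule.Build (group_zmod cG) (@mulgA gT) cG (@mul1g gT) (@mulVg gT).
End AbelianZmodule.

Section CocycleExtension.
Variables aT gT : finGroupType.

Definition cocycle (f : gT -> gT -> aT) :=
  forall g h k, f h k * f g (h * k) = f (g * h) k * f g h.

(** The central extension of gT by aT with factor set f. Commutativity and the
    cocycle identity are parameters of the type because the group law depends on
    them. *)
Definition cocycle_ext (f : gT -> gT -> aT)
  (cA : commutative (fun x y : aT => x * y)) (fP : cocycle f) : Type := (aT * gT)%type.

Variables (f : gT -> gT -> aT).
Variables (cA : commutative (fun x y : aT => x * y)) (fP : cocycle f).
Local Notation ext := (cocycle_ext cA fP).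

Lemma cocycle1g h : f 1 h = f 1 1.
Proof. by apply: (mulgI (f 1 h)); have := fP 1 1 h; rewrite !mul1g. Qed.

Lemma cocycleg1 g : f g 1 = f 1 1.
Proof. by apply: (mulIg (f g 1)); have := fP g 1 1; rewrite !mulg1. Qed.

Definition ext_mul (u v : ext) : ext := (u.1 * v.1 * f u.2 v.2, u.2 * v.2).
Definition ext_one : ext := ((f 1 1)^-1, 1).
Definition ext_inv (u : ext) : ext :=
  ((f 1 1)^-1 * (f u.2^-1 u.2)^-1 * u.1^-1, u.2^-1).

Lemma ext_mulA : associative ext_mul.
Proof.
move=> [a g] [b h] [c k]; congr (_, _); rewrite /= ?mulgA //.
rewrite -[RHS]mulgA [in RHS](cA c) -![in RHS]mulgA.
have -> : f g h * (f (g * h) k * c) = c * (f h k * f g (h * k)).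
  by rewrite fP [RHS]cA [f g h * _]mulgA [f g h * _]cA.
by rewrite !mulgA.
Qed.

Lemma ext_mul1 : left_id ext_one ext_mul.
Proof.
move=> [a g]; congr (_, _); rewrite /= ?mul1g //.
by rewrite (cocycle1g g) -mulgA cA mulgK.
Qed.

Lemma ext_mulV : left_inverse ext_one ext_inv ext_mul.
Proof.
move=> [a g]; congr (_, _); rewrite /= ?mulVg //.
by rewrite mulgKV -mulgA mulVg mulg1.
Qed.

HB.instance Definition _ := Finite.on ext.
HB.instance Definition _ := Finite_isGroup.Build ext ext_mulA ext_mul1 ext_mulV.

Definition ext_proj (u : ext) : gT := u.2.
(** The cocycle need not be normalised, hence the factor f 1 1. *)
Definition ext_inj (a : aT) : ext := (a * (f 1 1)^-1, 1).
Definition ext_sect (g : gT) : ext := (1, g).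

Lemma ext_projM : {in [set: ext] &, {morph ext_proj : u v / u * v}}.
Proof. by []. Qed.
Canonical ext_proj_morphism := Morphism ext_projM.

Lemma ext_inj_mull a (v : ext) : ext_inj a * v = (a * v.1, v.2) :> ext.
Proof.
congr (_, _); rewrite /= ?mul1g // (cocycle1g v.2).
by rewrite -!mulgA; congr (_ * _); rewrite cA mulgK.
Qed.

Lemma ext_inj_comm a (v : ext) : ext_inj a * v = v * ext_inj a.
Proof.
rewrite ext_inj_mull; case: v => b h; congr (_, _); rewrite /= ?mulg1 //.
by rewrite (cocycleg1 h) [in RHS]mulgA mulgKV cA.
Qed.

Lemma ext_injM a b : ext_inj (a * b) = ext_inj a * ext_inj b.
Proof. by rewrite ext_inj_mull /= mulgA. Qed.

Lemma ext_inj_inj : injective ext_inj.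
Proof. by move=> a b [] /mulIg. Qed.

Lemma ext_sectM g h : ext_sect g * ext_sect h = ext_inj (f g h) * ext_sect (g * h).
Proof. by rewrite ext_inj_mull; congr (_, _); rewrite /= !mul1g mulg1. Qed.

Lemma ker_ext_proj : 'ker ext_proj_morphism \subset 'Z([set: ext]).
Proof.
apply/subsetP=> u /morphpreP[_ /set1P u2]; apply/centerP.
split=> [|v _]; first exact: in_setT.
have -> : u = ext_inj (u.1 * f 1 1) by rewrite /ext_inj mulgK -u2; case: u {u2}.
exact: ext_inj_comm.
Qed.

Lemma ext_inj_ker a : ext_inj a \in 'ker ext_proj_morphism.
Proof. by apply/kerP; rewrite ?inE. Qed.

Lemma ext_quotient_isog : [set: ext] / 'ker ext_proj_morphism \isog [set: gT].
Proof.
have := first_isog ext_proj_morphism; congr (_ \isog _).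
apply/setP=> g; rewrite inE; apply/morphimP.
by exists (ext_sect g); rewrite ?inE.
Qed.

(** This is the inclusion of H_2 in the derived subgroup of the extension. In the
    abelianisation f g h becomes e(g) + e(h) - e(gh), where e(g) is the class of
    ext_sect g. So there the map k factors through bar_d2. *)
Lemma ext_inj_commutator (k : bar2 gT -> aT) c :
    (forall a b, k (a - b)%R = k a * (k b)^-1) ->
    (forall g h, k (free_gen (g, h)) = f g h) -> bar_d2 c = 0%R ->
  ext_inj (k c) \in [set: ext]^`(1).
Proof.
move=> kB kgen c_cycle; pose E' := ([set: ext]^`(1))%G.
have nE' u : u \in 'N(E') by rewrite (subsetP (der_norm 1 _)) ?inE.
have cQ : commutative (fun x y : coset_of E' => x * y).
  move=> x y; have /centsP cEE := der_abelian 0 [set: ext]%G.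
  have Qx (z : coset_of E') : z \in [set: ext] / E'.
    by rewrite -(coset_reprK z) mem_quotient ?inE.
  exact: cEE.
pose V : zmodType := group_zmod cQ.
pose psi (b : bar2 gT) : V := coset E' (ext_inj (k b)).
have kV a b : ext_inj (k (a - b)%R) * ext_inj (k b) = ext_inj (k a).
  by rewrite -ext_injM kB mulgKV.
have psiB a b : psi (a - b)%R = (psi a - psi b)%R.
  apply/eqP; rewrite eq_sym subr_eq; apply/eqP.
  by rewrite /psi -(kV a b) morphM.
have phiB := free_lift_morph (fun g => coset E' (ext_sect g) : V).
set phi := free_lift _ in phiB.
have phi_gen g : phi (free_gen g) = coset E' (ext_sect g) by apply: free_lift_gen.
have phi0 : phi 0%R = 0%R by have := phiB 0%R 0%R; rewrite !subrr.
suff psi_phi b : psi b = phi (bar_d2 b).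
  have: psi c = 0%R by rewrite psi_phi c_cycle phi0.
  by move/coset_idr; apply.
elim/free_ind: b => [|a b IHa IHb|[g h]].
- by rewrite raddf0 phi0; have := psiB 0%R 0%R; rewrite !subrr.
- by rewrite psiB raddfB phiB IHa IHb.
rewrite bar_d2_free_gen /bar_d2_gen.
have -> : (free_gen h - free_gen (g * h)%g + free_gen g =
    free_gen h - (free_gen (g * h)%g - free_gen g))%R by rewrite opprB addrA addrAC.
rewrite !phiB !phi_gen; apply/eqP; rewrite opprB addrA eq_sym subr_eq; apply/eqP.
rewrite addrC /psi kgen.
have := congr1 (coset E') (ext_sectM g h); rewrite !morphM //.
Qed.

End CocycleExtension.

(** * Bar cycles and the universal extension modulo N *)

Section Transfer.
Local Open Scope ring_scope.
Variable gT : finGroupType.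

Lemma bar_d3_free_gen (u : gT * gT * gT) : bar_d3 (free_gen u) = bar_d3_gen u.
Proof. exact: free_lift_gen. Qed.

(** Averaging: summing the cones [x|g|h] over all x gives a contracting homotopy
    for multiplication by |G|. *)
Lemma card_cycle_boundary (c : bar2 gT) :
  bar_d2 c = 0 -> exists a, c *+ #|gT| = bar_d3 a.
Proof.
pose h := free_lift (fun u : gT * gT => \sum_x free_gen (x, u.1, u.2) : bar3 gT).
pose s := free_lift (fun g : gT => \sum_x free_gen (x, g) : bar2 gT).
have hB : zmod_morphism h by apply: free_lift_morph.
have sB : zmod_morphism s by apply: free_lift_morph.
have s0 : s 0 = 0 by have := sB 0 0; rewrite !subrr.
suff homotopy b : b *+ #|gT| = bar_d3 (h b) + s (bar_d2 b).
  by move=> c0; exists (h c); rewrite homotopy c0 s0 addr0.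
elim/free_ind: b => [|a b IHa IHb|[g k]].
- have -> : h 0 = 0 by have := hB 0 0; rewrite !subrr.
  by rewrite mul0rn !raddf0 s0 addr0.
- by rewrite mulrnBl IHa IHb hB !raddfB sB opprD addrACA.
rewrite bar_d2_free_gen /bar_d2_gen.
have -> : free_gen k - free_gen (g * k)%g + free_gen g =
    free_gen k - (free_gen (g * k)%g - free_gen g) :> bar1 gT.
  by rewrite opprB addrA addrAC.
rewrite !sB /s /h !free_lift_gen raddf_sum /= -!sumrB -big_split /=.
under eq_bigr => x _ do rewrite bar_d3_free_gen /bar_d3_gen.
rewrite (eq_bigr (fun x =>
    free_gen (g, k) + (free_gen (x, k) - free_gen ((x * g)%g, k)))).
  rewrite big_split /= sumr_const sumrB.
  rewrite [X in _ + (X - _)](reindex_inj (mulIg g)) /= subrr addr0.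
  by rewrite cardT -cardE.
move=> x _; rewrite opprB !addrA.
by apply/ffunP=> y; rewrite !ffunE; ring.
Qed.

End Transfer.

Section ReductionModN.
Local Open Scope ring_scope.
Variables (gT : finGroupType) (N : nat).
Hypothesis N_gt1 : (1 < N)%N.

Lemma intr_Zp_eq0 (z : int) : (z%:~R == 0 :> 'Z_N) = (N %| z)%Z.
Proof.
have natP k : (k%:R == 0 :> 'Z_N) = (N %| k)%N.
  by rewrite -val_eqE /= val_Zp_nat.
by case: z => k; rewrite ?NegzE ?mulrNz ?oppr_eq0 natP dvdzE.
Qed.

(** Bar chains of degree 2 modulo N, tabulated as matrices in order to form a
    finite group. *)
Definition bar2_mod : finZmodType := 'M['Z_N]_#|gT|.

Definition red2 (c : bar2 gT) : bar2_mod :=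
  \matrix_(i, j) (c (enum_val i, enum_val j))%:~R.

Lemma red2_morph : zmod_morphism red2.
Proof. by move=> a b; apply/matrixP=> i j; rewrite !mxE !ffunE rmorphB. Qed.
HB.instance Definition _ :=
  GRing.isZmodMorphism.Build (bar2 gT) bar2_mod red2 red2_morph.

Lemma red2_eq0 c : red2 c = 0 -> exists c', c = c' *+ N.
Proof.
move/matrixP=> c0; exists [ffun u => (c u %/ N)%Z]; apply/ffunP=> -[g h].
rewrite ffunMnE ffunE -mulr_natr natz divzK // -intr_Zp_eq0.
by have := c0 (enum_rank g) (enum_rank h); rewrite !mxE !enum_rankK => ->.
Qed.

Definition red_boundary : {set bar2_mod} :=
  [set w | `[< exists a : bar3 gT, w = red2 (bar_d3 a) >]].

Lemma red_boundaryP w :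
  reflect (exists a : bar3 gT, w = red2 (bar_d3 a)) (w \in red_boundary).
Proof. by rewrite inE; apply: asboolP. Qed.

Lemma red_boundary_group_set : group_set red_boundary.
Proof.
apply/group_setP; split=> [|_ _ /red_boundaryP[a ->] /red_boundaryP[b ->]].
  by apply/red_boundaryP; exists 0; rewrite !raddf0.
by apply/red_boundaryP; exists (a + b); rewrite !raddfD.
Qed.
Canonical red_boundary_group := Group red_boundary_group_set.

Local Notation B := red_boundary_group.

(** The class of a bar chain modulo N and modulo boundaries. Its values on the
    symbols [g|h] form the universal cocycle with coefficients killed by N. *)
Definition bar_class (c : bar2 gT) : coset_of B := coset B (red2 c).

Let nB (w : bar2_mod) : w \in 'N(B)%g.
Proof.
by apply: (subsetP (cent_sub _)); apply/centP=> v _; apply: FinRing.zmod_mulgC.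
Qed.

Lemma bar_class_comm : commutative (fun x y : coset_of B => x * y)%g.
Proof.
move=> x y; rewrite -(coset_reprK x) -(coset_reprK y) -!morphM ?nB //.
by congr (coset _ _); apply: FinRing.zmod_mulgC.
Qed.

Lemma bar_classD a b : bar_class (a + b) = (bar_class a * bar_class b)%g.
Proof. by rewrite /bar_class raddfD /= -morphM ?nB. Qed.

Lemma bar_classB a b : bar_class (a - b) = (bar_class a * (bar_class b)^-1)%g.
Proof. by rewrite /bar_class raddfB /= -morphV ?nB // -morphM ?nB. Qed.

Lemma bar_classMn a k : bar_class (a *+ k) = (bar_class a ^+ k)%g.
Proof. by rewrite /bar_class raddfMn /= -morphX ?nB. Qed.

Lemma bar_class_eq1 c : bar_class c = 1%g -> exists a c', c = bar_d3 a + c' *+ N.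
Proof.
move/coset_idr=> /(_ (nB _))/red_boundaryP[a /eqP].
rewrite -subr_eq0 -raddfB => /eqP/red2_eq0[c' def_c].
by exists a, c'; rewrite -def_c addrC subrK.
Qed.

Lemma bar_class_d3 a : bar_class (bar_d3 a) = 1%g.
Proof. by apply: coset_id; apply/red_boundaryP; exists a. Qed.

Definition bar_cocycle (g h : gT) : coset_of B := bar_class (free_gen (g, h)).

Lemma bar_cocycleP : cocycle bar_cocycle.
Proof.
move=> g h k; rewrite /bar_cocycle -!bar_classD.
rewrite -[RHS]mul1g -(bar_class_d3 (free_gen (g, h, k))) bar_d3_free_gen -bar_classD.
congr bar_class; rewrite /bar_d3_gen.
by apply/ffunP=> y; rewrite !ffunE; ring.
Qed.

End ReductionModN.

Section HomologyExponent.
Local Open Scope ring_scope.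
Local Open Scope quotient_scope.

Lemma homology_exponent (A B C : zmodType) (d' : {additive A -> B})
    (d : {additive B -> C}) (m : nat) :
    (forall b, d b = 0 -> exists a, b *+ m = d' a) ->
  forall x : homology d' d, x *+ m = 0.
Proof.
move=> bound; elim/quotW=> c.
have [b cb dc0] : exists2 b, val c = b & d b = 0.
  by exists (val c) => //; apply/eqP; exact: (valP c).
have [a ba] := bound b dc0.
have -> : \pi_(homology d' d) c *+ m = \pi_(homology d' d) (c *+ m).
  by rewrite raddfMn.
rewrite -[0](raddf0 (\pi_(homology d' d))).
apply/eqP; rewrite -Quotient.idealrBE subr0; apply/asboolP.
by exists a; rewrite -ba -cb raddfMn.
Qed.

End HomologyExponent.

(** Take N = |G| and let E be the extension of G by the universal cocycle modulo
    N. The class of a cycle c lies in E' and in the kernel of E -> G, so its p-th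
    power is trivial, that is, p c is a boundary plus N c'. Applying bar_d2 shows
    that c' is a cycle, and then N c' is a boundary as well. *)
Lemma H2_exponent (gT : finGroupType) (p n : nat) :
    prime p -> 2 < p -> 3 < n -> n <= p.+1 ->
    #|[set: gT]| = (p ^ n)%N -> nil_class [set: gT] = n.-1 ->
  elementary_abelian p (H2 gT).
Proof.
move=> p_pr p_gt2 n_gt3 len oG clG; apply: homology_exponent => c dc0.
have oT : #|gT| = (p ^ n)%N by rewrite -oG cardsT.
have N_gt1 : 1 < p ^ n.
  by rewrite -(exp1n n) ltn_exp2r ?prime_gt1 // (ltn_trans _ n_gt3).
pose cA := @bar_class_comm gT (p ^ n).
pose fP := @bar_cocycleP gT (p ^ n).
pose k := @bar_class gT (p ^ n).
have isoQ := ext_quotient_isog cA fP.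
have oQ : #|[set: cocycle_ext cA fP] / 'ker (ext_proj_morphism cA fP)| = (p ^ n)%N.
  by rewrite (card_isog isoQ).
have clQ : nil_class ([set: cocycle_ext cA fP] / 'ker (ext_proj_morphism cA fP)) = n.-1.
  by rewrite (isog_nil_class isoQ).
have E'c : ext_inj cA fP (k c) \in [set: cocycle_ext cA fP]^`(1).
  by apply: ext_inj_commutator dc0 => // a b; apply: bar_classB.
have := central_ext_exponent p_pr p_gt2 n_gt3 len (ker_ext_proj cA fP) oQ clQ E'c
  (ext_inj_ker cA fP _).
have ext_inj1 : ext_inj cA fP 1 = 1 by congr (_, _); rewrite mul1g.
have ext_injX a j : ext_inj cA fP a ^+ j = ext_inj cA fP (a ^+ j).
  by elim: j => [|j IHj]; rewrite ?expg0 // !expgS IHj ext_injM.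
rewrite ext_injX -ext_inj1 => /ext_inj_inj; rewrite -bar_classMn.
move=> /(bar_class_eq1 N_gt1)[a [c' def_c]].
have dc'0 : bar_d2 c' = 0%R.
  have : (bar_d2 c' *+ (p ^ n)%N)%R = 0%R.
    have := congr1 (@bar_d2 gT) def_c.
    by rewrite raddfD raddfMn dc0 mul0rn /= bar_d2_d3 add0r raddfMn => <-.
  move/ffunP=> c0; apply/ffunP=> g; have := c0 g; rewrite ffunMnE !ffunE.
  move/eqP; rewrite Num.Theory.mulrn_eq0 => /orP[|/eqP//].
  by rewrite expn_eq0 -leqn0 leqNgt prime_gt0.
have [a' c'N] := card_cycle_boundary dc'0.
by exists (a + a')%R; rewrite def_c -oT c'N raddfD.
Qed.

Theorem theorem2 (p n : nat) (gT : finGroupType) (G : {group gT}) :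
  prime p -> odd p -> 4 <= n <= p.+1 -> maximal_class p n G ->
  elementary_abelian p (schur_multiplier G).
Proof.
move=> p_pr p_odd /andP[n_gt3 len] [oG clG].
have isoG := isog_subg G.
apply: (H2_exponent (n := n));
  by rewrite -?(card_isog isoG) -?(isog_nil_class isoG) ?odd_prime_gt2.
Qed.
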